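(* Let $(X,d)$ be a rectangular $b$-metric space with parameter $s>1$, let $\alpha,\eta:X\times X\to[0,+\infty)$ be two functions, and suppose that $(X,d)$ is $(\alpha,\eta)$-complete. Let $T:X\to X$ be a self-mapping satisfying the following conditions: (i) $T$ is a triangular $(\alpha,\eta)$-admissible mapping; (ii) $T$ is an $(\alpha,\eta)$-$\theta$-$\phi$-contraction; (iii) there exists $x_0\in X$ such that $\alpha(x_0,Tx_0)\ge 1$ or $\eta(x_0,Tx_0)\le 1$; (iv) $T$ is $(\alpha,\eta)$-continuous. Then $T$ has a fixed point. Moreover, $T$ has a unique fixed point when, for all $x,y\in X$, $\alpha(x,y)\ge 1$ or $\eta(x,y)\le 1$.
   Context: A rectangular $b$-metric space with parameter $s\ge 1$ is a nonempty set $X$ with a map $d:X\times X\to[0,+\infty)$ such that for all $x,y\in X$ and all distinct points $u,v\in X$, each distinct from $x$ and $y$: (1) $d(x,y)=0$ if and only if $x=y$; (2) $d(x,y)=d(y,x)$; (3) $d(x,y)\le s[d(x,u)+d(u,v)+d(v,y)]$. A sequence $(x_n)$ in $X$ converges to $x$ (written $x_n\to x$) if $d(x_n,x)\to 0$, and is Cauchy if $d(x_n,x_m)\to 0$ as $n,m\to\infty$. $(X,d)$ is $(\alpha,\eta)$-complete if every Cauchy sequence $(x_n)$ in $X$ such that, for all $n\in\mathbb{N}$, $\alpha(x_n,x_{n+1})\ge1$ or $\eta(x_n,x_{n+1})\le 1$, converges in $X$. $T$ is triangular $(\alpha,\eta)$-admissible if for all $x,y,z\in X$: (T1) $\alpha(x,y)\ge1\Rightarrow\alpha(Tx,Ty)\ge1$;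 (T2) $\eta(x,y)\le1\Rightarrow\eta(Tx,Ty)\le1$; (T3) $\alpha(x,y)\ge1$ and $\alpha(y,z)\ge1$ imply $\alpha(x,z)\ge1$; (T4) $\eta(x,y)\le1$ and $\eta(y,z)\le1$ imply $\eta(x,z)\le1$. $T$ is $(\alpha,\eta)$-continuous if for every $x\in X$ and every sequence $(x_n)$ in $X$ with $x_n\to x$ and, for all $n\in\mathbb{N}$, $\alpha(x_n,x_{n+1})\ge1$ or $\eta(x_n,x_{n+1})\le1$, one has $Tx_n\to Tx$. $\Theta$ is the set of functions $\theta:(0,\infty)\to(1,\infty)$ such that: $\theta$ is increasing; for each sequence $(t_n)$ in $(0,\infty)$, $\lim_{n\to\infty}\theta(t_n)=1$ if and only if $\lim_{n\to\infty}t_n=0$; $\theta$ is continuous on $(0,\infty)$. $\Phi$ is the set of functions $\phi:[1,\infty)\to[1,\infty)$ such that: $\phi$ is non-decreasing; for each $t>1$, $\lim_{n\to\infty}\phi^n(t)=1$ (where $\phi^n$ is the $n$-th iterate); $\phi$ is continuous on $[1,\infty)$. $T$ is an $(\alpha,\eta)$-$\theta$-$\phi$-contraction (on a rectangular $b$-metric space with parameter $s>1$) if there are $\theta\in\Theta$, $\phi\in\Phi$ and reals $\beta_1,\beta_2,\beta_3,\beta_4\ge0$ with $\beta_1+\beta_2+\beta_3+\beta_4\le1$ and $\beta_3<\frac1s$ such that for all $x,y\in X$ with ($\alpha(x,y)\ge1$ or $\eta(x,y)\le1$) and $d(Tx,Ty)>0$, $$\theta\big(s^2 d(Tx,Ty)\big)\le\phi\Big[\theta\big(\beta_1d(x,y)+\beta_2d(Tx,x)+\beta_3d(Ty,y)+\beta_4d(y,Tx)\big)\Big].$$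 Since $\theta$ is defined only on $(0,\infty)$, this requirement includes that the argument of $\theta$ on the right-hand side is positive. *)

(* Defs.v *)
From mathcomp Require Import all_boot all_order all_algebra.
From mathcomp Require Import all_classical all_reals all_analysis.
Import Order.TTheory GRing.Theory Num.Theory.
Import numFieldNormedType.Exports.

Set Implicit Arguments.
Unset Strict Implicit.
Unset Printing Implicit Defensive.

Local Open Scope classical_set_scope.
Local Open Scope ring_scope.

Record rectangular_bmetric (R : realType) (X : Type) (s : R) (d : X -> X -> R) :
    Prop := RectangularBMetric {
  rbm_inhabited : inhabited X ;
  rbm_param : 1 <= s ;
  rbm_ge0 : forall x y, 0 <= d x y ;
  rbm_eq0 : forall x y, d x y = 0 <-> x = y ;
  rbm_sym : forall x y, d x y = d y x ;
  (* The quadrilateral inequality is only required when u and v are distinct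
     from each other and from both x and y; x = y is not excluded. *)
  rbm_quad : forall x y u v, u <> v -> u <> x -> u <> y -> v <> x -> v <> y ->
    d x y <= s * (d x u + d u v + d v y)
}.

(* d does not come from a uniform structure in general (limits need not be
   unique, d need not be continuous), so convergence and the Cauchy property
   are stated on the real-valued distances. *)
Definition d_cvg (R : realType) (X : Type) (d : X -> X -> R)
    (x : nat -> X) (l : X) : Prop :=
  d (x n) l @[n --> \oo] --> (0 : R).

Definition d_cauchy (R : realType) (X : Type) (d : X -> X -> R)
    (x : nat -> X) : Prop :=
  d (x nm.1) (x nm.2) @[nm --> (\oo, \oo)] --> (0 : R).

Definition ae_complete (R : realType) (X : Type) (alpha eta d : X -> X -> R) :
    Prop :=
  forall x : nat -> X, d_cauchy d x ->
    (forall n, 1 <= alpha (x n) (x n.+1) \/ eta (x n) (x n.+1) <= 1) ->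
    exists l, d_cvg d x l.

Record triangular_ae_admissible (R : realType) (X : Type)
    (alpha eta : X -> X -> R) (T : X -> X) : Prop := TriangularAEAdmissible {
  tae_alpha : forall x y, 1 <= alpha x y -> 1 <= alpha (T x) (T y) ;
  tae_eta : forall x y, eta x y <= 1 -> eta (T x) (T y) <= 1 ;
  tae_alpha_trans : forall x y z,
    1 <= alpha x y -> 1 <= alpha y z -> 1 <= alpha x z ;
  tae_eta_trans : forall x y z,
    eta x y <= 1 -> eta y z <= 1 -> eta x z <= 1
}.

Definition ae_continuous (R : realType) (X : Type) (alpha eta d : X -> X -> R)
    (T : X -> X) : Prop :=
  forall (l : X) (x : nat -> X), d_cvg d x l ->
    (forall n, 1 <= alpha (x n) (x n.+1) \/ eta (x n) (x n.+1) <= 1) ->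
    d_cvg d (T \o x) (T l).

(* Functions from ]0, +oo[ to ]1, +oo[ are represented by total functions whose
   values outside ]0, +oo[ are irrelevant. *)
Record Theta (R : realType) (theta : R -> R) : Prop := IsTheta {
  Theta_gt1 : forall t : R, 0 < t -> 1 < theta t ;
  Theta_incr : {in `]0, +oo[ &, {homo theta : t u / t < u}} ;
  Theta_lim : forall t : nat -> R, (forall n, 0 < t n) ->
    (theta (t n) @[n --> \oo] --> (1 : R)) <-> (t n @[n --> \oo] --> (0 : R)) ;
  Theta_cont : {within `]0, +oo[, continuous theta}
}.

(* Likewise, only the values on [1, +oo[ matter. *)
Record Phi (R : realType) (phi : R -> R) : Prop := IsPhi {
  Phi_ge1 : forall t, 1 <= t -> 1 <= phi t ;
  Phi_ndecr : {in `[1, +oo[ &, {homo phi : t u / t <= u}} ;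
  Phi_iter : forall t, 1 < t -> iter n phi t @[n --> \oo] --> (1 : R) ;
  Phi_cont : {within `[1, +oo[, continuous phi}
}.

Definition ae_theta_phi_contraction (R : realType) (X : Type) (s : R)
    (alpha eta d : X -> X -> R) (T : X -> X) : Prop :=
  exists theta phi : R -> R, Theta theta /\ Phi phi /\
  exists b1 b2 b3 b4 : R,
    [/\ 0 <= b1, 0 <= b2, 0 <= b3 & 0 <= b4] /\
    b1 + b2 + b3 + b4 <= 1 /\ b3 < s^-1 /\
    forall x y, 1 <= alpha x y \/ eta x y <= 1 -> 0 < d (T x) (T y) ->
      let r := b1 * d x y + b2 * d (T x) x + b3 * d (T y) y + b4 * d y (T x) in
      (* theta is only meaningful on positive arguments *)
      0 < r /\ theta (s ^+ 2 * d (T x) (T y)) <= phi (theta r).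

(* Main.v *)
Require Import Defs.
From mathcomp Require Import all_boot all_order all_algebra.
From mathcomp Require Import all_classical all_reals all_analysis.
From mathcomp Require Import zify ring lra.
Import Order.TTheory GRing.Theory Num.Theory.
Import numFieldNormedType.Exports.
Set Implicit Arguments.
Unset Strict Implicit.

Local Open Scope classical_set_scope.
Local Open Scope ring_scope.

(** Since [phi t < t] for [t > 1] and [theta] is increasing, the contraction
    condition gives the linear bound [s^2 d(Tx,Ty) < r(x,y)].  For the orbit
    [x_n = T^n x0] it makes both [d(x_n,x_(n+1))] and [d(x_n,x_(n+2))] at most
    [C s^(-2n)]; the quadrilateral inequality, applied in jumps of length two,
    then yields [d(x_n,x_m) <= A s^(-2n)] for [n < m], because
    [s * (s^-2)^2 < 1].  The limit of the orbit is a fixed point by continuity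
    of [T] and one more quadrilateral inequality. *)

(** * Removing [theta] and [phi] from the contraction condition *)

Lemma Phi_lt (R : realType) (phi : R -> R) (t : R) :
  Phi phi -> 1 < t -> phi t < t.
Proof.
move=> Hphi t1; rewrite ltNge; apply/negP => tphi.
(* If [t <= phi t], monotonicity keeps every iterate above [t], so their limit 1 would be at least
   [t]. *)
have le_iter n : t <= iter n phi t.
  elim: n => //= n IH; apply: (le_trans tphi).
  by apply: (Phi_ndecr Hphi) => //; rewrite in_itv /= andbT; lra.
have : t <= 1.
  rewrite -(cvg_lim (@Rhausdorff R) (Phi_iter Hphi t1)).
  apply: limr_ge; first by apply/cvg_ex; exists 1; exact: (Phi_iter Hphi).
  by near=> n; exact: le_iter.
by lra.
Unshelve. all: by end_near. Qed.

Lemma Theta_Phi_lt (R : realType) (theta phi : R -> R) (u r : R) :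
  Theta theta -> Phi phi -> 0 < u -> 0 < r ->
  theta u <= phi (theta r) -> u < r.
Proof.
move=> Htheta Hphi u0 r0 le_ur.
have lt_ur := le_lt_trans le_ur (Phi_lt Hphi (Theta_gt1 Htheta r0)).
case: (ltgtP r u) lt_ur => // [ru|->]; last by rewrite ltxx.
have : theta r < theta u.
  by apply: (Theta_incr Htheta); rewrite // in_itv /= andbT.
by lra.
Qed.

(** * Cauchy sequences and limits in a rectangular b-metric space *)

Lemma rbm_gt0 (R : realType) (X : Type) (s : R) (d : X -> X -> R) (x y : X) :
  rectangular_bmetric s d -> x <> y -> 0 < d x y.
Proof.
move=> Hd xy; rewrite lt0r (rbm_ge0 Hd) andbT.
by apply/eqP => /(rbm_eq0 Hd).
Qed.

Lemma rbm_xx (R : realType) (X : Type) (s : R) (d : X -> X -> R) (x : X) :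
  rectangular_bmetric s d -> d x x = 0.
Proof. by move=> Hd; apply/(rbm_eq0 Hd). Qed.

(** Passing through [x n.+1] and [x n.+2] shortens a gap by two, and the points are distinct only if
    the gap is at least three. Gaps one and two are therefore both base cases. *)
Lemma rbm_geometric_bound (R : realType) (X : Type) (s : R) (d : X -> X -> R)
    (x : nat -> X) (C q : R) :
  rectangular_bmetric s d -> injective x -> 0 <= q -> s * q ^+ 2 < 1 ->
  (forall n, d (x n) (x n.+1) <= C * q ^+ n) ->
  (forall n, d (x n) (x n.+2) <= C * q ^+ n) ->
  exists A, forall n p, d (x n) (x (n + p)%N) <= A * q ^+ n.
Proof.
move=> Hd xI q0 sq1 D1 D2; have s1 := rbm_param Hd.
have C0 : 0 <= C.
  by have := D1 0%N; rewrite expr0 mulr1; exact: le_trans (rbm_ge0 Hd _ _).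
(* [A] is the fixed point of the recursion that one quadrilateral step produces, stated in [AE]. *)
pose A := s * C * (1 + q) / (1 - s * q ^+ 2).
have AE : A = s * C * (1 + q) + A * (s * q ^+ 2).
  by rewrite /A; field; lra.
have A0 : 0 <= A.
  by apply: divr_ge0; [rewrite !mulr_ge0 // ; lra | lra].
have sC : C <= s * C * (1 + q).
  rewrite -[leLHS]mul1r -[leLHS]mulr1; apply: ler_pM => //.
  - by rewrite mul1r.
  - exact: ler_wpM2r.
  - by lra.
have CA : C <= A.
  rewrite AE (le_trans sC) // lerDl mulr_ge0 // mulr_ge0 ?exprn_ge0 //; lra.
exists A => n p; elim/ltn_ind: p n => -[|[|[|p]]] IH n.
- by rewrite addn0 (rbm_xx _ Hd) mulr_ge0 ?exprn_ge0.
- by rewrite addn1 (le_trans (D1 n)) // ler_wpM2r ?exprn_ge0.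
- by rewrite addn2 (le_trans (D2 n)) // ler_wpM2r ?exprn_ge0.
have neq i j : i != j -> x i <> x j by move=> /eqP ij /xI.
apply: (le_trans (rbm_quad Hd (u := x n.+1) (v := x n.+2) _ _ _ _ _));
  try by apply: neq; lia.
have := IH p.+1 ltac:(lia) n.+2.
rewrite (_ : (n.+2 + p.+1 = n + p.+3)%N); last by lia.
have := D1 n; have := D1 n.+1.
rewrite !exprS => h1 h2 h3.
rewrite [X in _ <= X * _]AE expr2.
set a := d _ _ in h2 *; set b := d _ _ in h1 *; set c := d _ _ in h3 *.
set Q := q ^+ n in h1 h2 h3 *.
have h : a + b + c <= C * Q + C * (q * Q) + A * (q * (q * Q)) by lra.
apply: (le_trans (ler_wpM2l _ h)); first by lra.
by lra.
Qed.

Lemma geometric_d_cauchy (R : realType) (X : Type) (s : R) (d : X -> X -> R)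
    (x : nat -> X) (A q : R) :
  rectangular_bmetric s d -> 0 <= q -> q < 1 ->
  (forall n p, d (x n) (x (n + p)%N) <= A * q ^+ n) -> d_cauchy d x.
Proof.
move=> Hd q0 q1 HA.
have A0 : 0 <= A.
  by have := HA 0%N 0%N; rewrite expr0 mulr1; exact: le_trans (rbm_ge0 Hd _ _).
have cvgq : A * q ^+ n @[n --> \oo] --> (0 : R).
  rewrite -(mulr0 A); apply: cvgMr; apply: cvg_expr.
  by rewrite ger0_norm.
apply/cvgrPdist_le => e e0.
have /cvgrPdist_le /(_ e e0) [N _ HN] := cvgq.
exists ([set n | (N <= n)%N], [set n | (N <= n)%N]).
  by split; exists N.
move=> [n m] /= [Nn Nm]; rewrite sub0r normrN ger0_norm ?(rbm_ge0 Hd) //.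
have bound k : (N <= k)%N -> A * q ^+ k <= e.
  move=> /HN /=; rewrite sub0r normrN ger0_norm // mulr_ge0 // exprn_ge0 //.
have [nm|/ltnW mn] := leqP n m.
- by rewrite -(subnKC nm) (le_trans (HA _ _)) // bound.
- by rewrite (rbm_sym Hd) -(subnKC mn) (le_trans (HA _ _)) // bound.
Qed.

(** An injective sequence meets [z] at most once; this supplies the distinctness conditions of the
    quadrilateral inequality in the limit. *)
Lemma near_injective_neq (X : Type) (x : nat -> X) (z : X) :
  injective x -> \forall n \near \oo, x n <> z.
Proof.
move=> xI; have [[k <-]|nz] := pselect (exists k, x k = z).
  by exists k.+1 => // n /= kn /xI nk; lia.
by near=> n => xn; apply: nz; exists n.
Unshelve. all: by end_near. Qed.

(** Limits need not be unique in general. Here [l], [x n], [x n.+1], [l'] satisfy the quadrilateral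
    inequality for large [n], and its three sides tend to 0. *)
Lemma rbm_cvg_shift_eq (R : realType) (X : Type) (s : R) (d : X -> X -> R)
    (x : nat -> X) (l l' : X) :
  rectangular_bmetric s d -> injective x ->
  d (x n) (x n.+1) @[n --> \oo] --> (0 : R) ->
  d_cvg d x l -> d_cvg d (fun n => x n.+1) l' -> l = l'.
Proof.
move=> Hd xI Hx Hl Hl'.
have xSI : injective (fun n => x n.+1) by move=> m n /xI [].
apply/(rbm_eq0 Hd)/eqP; rewrite eq_le (rbm_ge0 Hd) andbT.
have neqS z : \forall n \near \oo, x n.+1 <> z.
  exact: (near_injective_neq z xSI).
have lim0 : s * (d (x n) l + d (x n) (x n.+1) + d (x n.+1) l') @[n --> \oo]
    --> (0 : R).
  rewrite -(mulr0 s); apply: cvgMr.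
  by rewrite -(addr0 0); apply: cvgD => //; rewrite -(addr0 0); apply: cvgD.
rewrite -(cvg_lim (@Rhausdorff R) lim0).
apply: limr_ge; first by apply/cvg_ex; exists 0.
near=> n; rewrite (rbm_sym Hd (x n) l); apply: (rbm_quad Hd).
- by move=> /xI; lia.
- by near: n; exact: near_injective_neq.
- by near: n; exact: near_injective_neq.
- by near: n; exact: neqS.
- by near: n; exact: neqS.
Unshelve. all: by end_near. Qed.

(** * Orbits and fixed points of the contraction *)

Lemma contraction_lt (R : realType) (X : Type) (s : R)
    (alpha eta d : X -> X -> R) (T : X -> X) :
  0 < s -> ae_theta_phi_contraction s alpha eta d T ->
  exists b1 b2 b3 b4 : R,
    [/\ 0 <= b1, 0 <= b2, 0 <= b3 & 0 <= b4] /\ b1 + b2 + b3 + b4 <= 1 /\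
    forall x y, 1 <= alpha x y \/ eta x y <= 1 -> 0 < d (T x) (T y) ->
      s ^+ 2 * d (T x) (T y) <
      b1 * d x y + b2 * d (T x) x + b3 * d (T y) y + b4 * d y (T x).
Proof.
move=> s0 [theta [phi [Htheta [Hphi]]]] [b1 [b2 [b3 [b4 [b0 [b_le1 [_ H]]]]]]].
exists b1, b2, b3, b4; split=> //; split=> // x y xy Txy.
have [r0 le_r] := H _ _ xy Txy.
by apply: (Theta_Phi_lt Htheta Hphi) le_r => //; rewrite mulr_gt0 ?exprn_gt0.
Qed.

(** Transitivity holds for each alternative separately, not for the disjunction; the alternative
    satisfied at [x0] propagates along the whole orbit. *)
Lemma orbit_admissible (R : realType) (X : Type) (alpha eta : X -> X -> R)
    (T : X -> X) (x0 : X) :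
  triangular_ae_admissible alpha eta T ->
  1 <= alpha x0 (T x0) \/ eta x0 (T x0) <= 1 ->
  let x n := iter n T x0 in
  forall n, (1 <= alpha (x n) (x n.+1) \/ eta (x n) (x n.+1) <= 1) /\
            (1 <= alpha (x n) (x n.+2) \/ eta (x n) (x n.+2) <= 1).
Proof.
move=> Hadm [h|h] x.
  have H n : 1 <= alpha (x n) (x n.+1).
    by elim: n => //= n; exact: (tae_alpha Hadm).
  move=> n; split; left; first exact: H.
  exact: (tae_alpha_trans Hadm (H n) (H n.+1)).
have H n : eta (x n) (x n.+1) <= 1.
  by elim: n => //= n; exact: (tae_eta Hadm).
move=> n; split; right; first exact: H.
exact: (tae_eta_trans Hadm (H n) (H n.+1)).
Qed.

Lemma convex_comb_le (R : realType) (b1 b2 b3 b4 u1 u2 u3 u4 M : R) :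
  [/\ 0 <= b1, 0 <= b2, 0 <= b3 & 0 <= b4] -> b1 + b2 + b3 + b4 <= 1 ->
  0 <= M -> u1 <= M -> u2 <= M -> u3 <= M -> u4 <= M ->
  b1 * u1 + b2 * u2 + b3 * u3 + b4 * u4 <= M.
Proof.
move=> [b1_ge0 b2_ge0 b3_ge0 b4_ge0] b_le1 M0 h1 h2 h3 h4.
have le_bM : (b1 + b2 + b3 + b4) * M <= M by exact: ler_piMl.
apply: le_trans le_bM; rewrite !mulrDl.
by do !apply: lerD; exact: ler_wpM2l.
Qed.

Lemma orbit_geometric (R : realType) (X : Type) (s : R)
    (alpha eta d : X -> X -> R) (T : X -> X) (x0 : X) :
  1 < s -> rectangular_bmetric s d -> triangular_ae_admissible alpha eta T ->
  ae_theta_phi_contraction s alpha eta d T ->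
  1 <= alpha x0 (T x0) \/ eta x0 (T x0) <= 1 ->
  (forall x, T x <> x) ->
  let x n := iter n T x0 in let q := (s ^+ 2)^-1 in
  injective x /\ exists C, forall n, d (x n) (x n.+1) <= C * q ^+ n /\
                                     d (x n) (x n.+2) <= C * q ^+ n.
Proof.
move=> s1 Hd Hadm Hcontr Hx0 nofix x q.
have [b1 [b2 [b3 [b4 [b0 [b_le1 H]]]]]] :=
  contraction_lt (lt_trans ltr01 s1) Hcontr.
have Hx := orbit_admissible Hadm Hx0.
have s2 : 1 < s ^+ 2 by rewrite exprn_egt1.
have q0 : 0 < q by rewrite invr_gt0; lra.
have qE (a b : R) : s ^+ 2 * a <= b -> a <= q * b.
  by move=> ab; rewrite /q mulrC ler_pdivlMr 1?mulrC //; lra.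
have D_gt0 n : 0 < d (x n) (x n.+1).
  by apply: (rbm_gt0 Hd) => /esym; exact: nofix.
have DS n : s ^+ 2 * d (x n.+1) (x n.+2) < d (x n) (x n.+1).
  have [Hx1 _] := Hx n.
  have lt_r := H _ _ Hx1 (D_gt0 n.+1).
  (* The four distances are two copies of [d (x n) (x n.+1)], then [d (x n.+1) (x n.+2)], and 0. The
     maximum cannot be the second one, since [1 < s ^+ 2]. *)
  have : s ^+ 2 * d (x n.+1) (x n.+2) <
      Num.max (d (x n) (x n.+1)) (d (x n.+1) (x n.+2)).
    apply: (lt_le_trans lt_r); apply: convex_comb_le => //.
    - by rewrite le_max (rbm_ge0 Hd).
    - by rewrite le_max lexx.
    - by rewrite (rbm_sym Hd) le_max lexx.
    - by rewrite (rbm_sym Hd) le_max lexx orbT.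
    - by rewrite (rbm_xx _ Hd) le_max (rbm_ge0 Hd).
  rewrite lt_max => /orP [//|]; rewrite ltNge ler_peMl ?(rbm_ge0 Hd) //.
  exact: ltW.
have Dlt n : d (x n.+1) (x n.+2) < d (x n) (x n.+1).
  by apply: le_lt_trans (DS n); rewrite ler_peMl ?(rbm_ge0 Hd) // ltW.
(* A repeated point would repeat its distance to the next point, but these distances strictly
   decrease. *)
have xneq n p : x n <> x (n + p.+1)%N.
  move=> E; have lt_D : d (x (n + p.+1)%N) (x (n + p.+1).+1) < d (x n) (x n.+1).
    elim: p {E} => [|p IH]; first by rewrite addn1.
    by rewrite addnS; exact: lt_trans (Dlt _) IH.
  by move: lt_D; rewrite /x /= -!/(x _) -E ltxx.
split.
  move=> m n mn; have [mltn|nltm|//] := ltngtP m n.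
    by case: (xneq m (n - m.+1)%N); rewrite mn; congr x; lia.
  by case: (xneq n (m - n.+1)%N); rewrite -mn; congr x; lia.
pose C := Num.max (d (x 0) (x 1)) (d (x 0) (x 2)).
exists C; elim=> [|n [IH1 IH2]].
  by rewrite expr0 mulr1 !le_max !lexx orbT.
rewrite exprS mulrCA; split; apply: qE.
  exact: le_trans (ltW (DS n)) IH1.
have [_ Hx2] := Hx n.
have Tx_gt0 : 0 < d (x n.+1) (x n.+3).
  by apply: (rbm_gt0 Hd); have := xneq n.+1 1%N; rewrite addn2.
(* Besides [d (x n) (x n.+2)], only consecutive distances from index [n] on occur, and they
   decrease. *)
apply: (le_trans (ltW (H _ _ Hx2 Tx_gt0))); apply: convex_comb_le => //.
- exact: le_trans (rbm_ge0 Hd _ _) IH1.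
- by rewrite (rbm_sym Hd).
- rewrite (rbm_sym Hd) (le_trans (ltW (Dlt n.+1))) //.
  by rewrite (le_trans (ltW (Dlt n))).
- by rewrite (rbm_sym Hd) (le_trans (ltW (Dlt n))).
Qed.

Unset Implicit Arguments.

Theorem theorem3p3 (R : realType) (X : Type) (s : R) (d : X -> X -> R)
    (alpha eta : X -> X -> R) (T : X -> X)
    (Hs : 1 < s) (Hd : rectangular_bmetric s d)
    (Halpha : forall x y, 0 <= alpha x y)
    (Heta : forall x y, 0 <= eta x y)
    (Hcomplete : ae_complete alpha eta d)
    (Hadm : triangular_ae_admissible alpha eta T)
    (Hcontr : ae_theta_phi_contraction s alpha eta d T)
    (Hx0 : exists x0, 1 <= alpha x0 (T x0) \/ eta x0 (T x0) <= 1)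
    (Hcont : ae_continuous alpha eta d T) :
  (exists x, T x = x) /\
  ((forall x y, 1 <= alpha x y \/ eta x y <= 1) -> exists! x, T x = x).
Proof.
have s2 : 1 < s ^+ 2 by rewrite exprn_egt1.
have fixT : exists x, T x = x.
  apply: contrapT => /forallNP nofix.
  have [x0 h0] := Hx0; pose q := (s ^+ 2)^-1.
  have [xI [C HC]] := orbit_geometric Hs Hd Hadm Hcontr h0 nofix.
  have q0 : 0 <= q by rewrite invr_ge0; lra.
  have q1 : q < 1 by rewrite invf_lt1; lra.
  have sq : s * q ^+ 2 < 1.
    have -> : s * q ^+ 2 = s^-1 * q by rewrite /q; field; lra.
    by rewrite mulr_ilt1 ?invr_ge0 ?invf_lt1; lra.
  have [A HA] := rbm_geometric_bound Hd xI q0 sq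
    (fun n => (HC n).1) (fun n => (HC n).2).
  have Hx n := (orbit_admissible Hadm h0 n).1.
  have [l Hl] := Hcomplete _ (geometric_d_cauchy Hd q0 q1 HA) Hx.
  (* Continuity sends the orbit, shifted by one, to [T l], while the orbit itself tends to [l]. *)
  apply: (nofix l); apply/esym.
  apply: (rbm_cvg_shift_eq Hd xI _ Hl); last exact: (Hcont _ _ Hl Hx).
  have cvgq : C * q ^+ n @[n --> \oo] --> (0 : R).
    by rewrite -(mulr0 C); apply: cvgMr; apply: cvg_expr; rewrite ger0_norm.
  apply: (squeeze_cvgr _ (cvg_cst (0 : R)) cvgq).
  by near=> n; rewrite (rbm_ge0 Hd) /=; exact: (HC n).1.
split=> // all_ae; have [z Tz] := fixT; exists z; split=> // u Tu.
apply: contrapT => zu; have zu0 := rbm_gt0 Hd zu.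
have [b1 [b2 [b3 [b4 [b0 [b_le1 H]]]]]] :=
  contraction_lt (lt_trans ltr01 Hs) Hcontr.
(* At two fixed points the right-hand distances are [d z u] or 0, so their combination is at most
   [d z u], hence at most [s ^+ 2 * d z u]. *)
have := H z u (all_ae z u); rewrite Tz Tu => /(_ zu0).
rewrite ltNge; apply/negP/negPn.
apply: (@le_trans _ _ (d z u)); last by rewrite ler_peMl ?ltW.
by apply: convex_comb_le => //; rewrite ?(rbm_xx _ Hd) ?(ltW zu0) // (rbm_sym Hd).
Unshelve. all: by end_near. Qed.
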